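(* The relation $E^{ce}_{\mathrm{set}}$ is finitarily reducible to $E^{ce}_3$, i.e. $E^{ce}_{\mathrm{set}}\leq_c^{<\omega}E^{ce}_3$.
   Context: $W_e$ is the $e$-th c.e. set. For $A\subseteq\omega$ and $n\in\omega$, $A^{[n]}=\{x:\langle x,n\rangle\in A\}$ is the $n$-th column of $A$, where $\langle\cdot,\cdot\rangle$ is the standard computable pairing function. $i\,E^{ce}_{\mathrm{set}}\,j\iff\{W_i^{[n]}:n\in\omega\}=\{W_j^{[n]}:n\in\omega\}$, and $i\,E^{ce}_3\,j\iff$ for every $n$, the symmetric difference $W_i^{[n]}\triangle W_j^{[n]}$ is finite. For equivalence relations $E,F$ on $\omega$, $E\leq_c^{<\omega}F$ means there is a single total computable function which, given $n\ge1$ and an $n$-tuple $(x_0,\dots,x_{n-1})$, outputs an $n$-tuple $(y_0,\dots,y_{n-1})$ with $x_i\,E\,x_j\iff y_i\,F\,y_j$ for all $i<j<n$. *)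

(* Defs.v *)
From mathcomp Require Import all_boot.
Set Implicit Arguments. Unset Strict Implicit. Unset Printing Implicit Defensive.

Inductive prog : Type :=
| PZero
| PSucc
| PProj (i : nat)
| PComp (f g : prog)
| PPair (f g : prog)
| PRec  (f g : prog)
| PMu   (f : prog).

Inductive eval : prog -> seq nat -> seq nat -> Prop :=
| eZero xs : eval PZero xs [:: 0]
| eSucc xs : eval PSucc xs [:: (head 0 xs).+1]
| eProj i xs : eval (PProj i) xs [:: nth 0 xs i]
| eComp f g xs ys zs : eval g xs ys -> eval f ys zs -> eval (PComp f g) xs zs
| ePair f g xs ys zs : eval f xs ys -> eval g xs zs -> eval (PPair f g) xs (ys ++ zs)
| eRec0 f g ys zs : eval f ys zs -> eval (PRec f g) (0 :: ys) zs
| eRecS f g n ys r zs :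
    eval (PRec f g) (n :: ys) r -> eval g (n :: r ++ ys) zs ->
    eval (PRec f g) (n.+1 :: ys) zs
| eMu f xs n :
    (forall m, m < n -> exists ys, eval f (m :: xs) ys /\ head 0 ys <> 0) ->
    (exists ys, eval f (n :: xs) ys /\ head 0 ys = 0) ->
    eval (PMu f) xs [:: n].

Fixpoint decode (t : GenTree.tree nat) : option prog :=
  match t with
  | GenTree.Node 0 [::] => Some PZero
  | GenTree.Node 1 [::] => Some PSucc
  | GenTree.Node 2 [:: GenTree.Leaf i] => Some (PProj i)
  | GenTree.Node 3 [:: a; b] =>
      match decode a, decode b with Some f, Some g => Some (PComp f g) | _, _ => None end
  | GenTree.Node 4 [:: a; b] =>
      match decode a, decode b with Some f, Some g => Some (PPair f g) | _, _ => None end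
  | GenTree.Node 5 [:: a; b] =>
      match decode a, decode b with Some f, Some g => Some (PRec f g) | _, _ => None end
  | GenTree.Node 6 [:: a] =>
      match decode a with Some f => Some (PMu f) | None => None end
  | _ => None
  end.

Definition prog_of_nat (e : nat) : option prog :=
  obind decode (unpickle e : option (GenTree.tree nat)).

Definition W (e x : nat) : Prop :=
  match prog_of_nat e with
  | Some p => exists ys, eval p [:: x] ys
  | None => False
  end.

(* Standard (Cantor) computable pairing function. *)
Definition cpair (x y : nat) : nat := 'C(x + y + 1, 2) + y.

Definition Wcol (e n x : nat) : Prop := W e (cpair x n).

Definition Eset (i j : nat) : Prop :=
  (forall n, exists m, forall x, Wcol i n x <-> Wcol j m x) /\
  (forall m, exists n, forall x, Wcol i n x <-> Wcol j m x).

Definition E3 (i j : nat) : Prop :=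
  forall n, exists b, forall x, b <= x -> (Wcol i n x <-> Wcol j n x).

Definition fin_reducible (E F : nat -> nat -> Prop) : Prop :=
  exists p : prog,
    (forall m, exists out, eval p [:: m] out) /\
    forall xs : seq nat, 0 < size xs ->
      exists out ys,
        eval p [:: pickle xs] out /\
        unpickle (head 0 out) = Some ys /\
        size ys = size xs /\
        forall i j, i < j -> j < size xs ->
          (E (nth 0 xs i) (nth 0 xs j) <-> F (nth 0 ys i) (nth 0 ys j)).

(* Main.v *)
(** Given a tuple xs, each column c of the sets to be built guesses a set S of positions of the
tuple together with, for every a in S and b not in S, a witness k(a, b) for the non-equivalence of
xs_a and xs_b: a column of one of W_(xs_a), W_(xs_b) that differs from all columns of the other.
The guess is wrong iff some z = (a, b, m) is good, meaning that the chosen column does equal column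
m of the other set; this is a Pi_2 condition, forall u, G(z, u), with G c.e. and antitone in u. Put
H(z, t) := exists z' <= z, G(z', t). In column c the positions in S enumerate {<z, t> : H(z, t)},
the others {<z, t> : t = 0 or H(z, t - 1)}. For fixed z these two sets differ at exactly one t if
no z' <= z is good, and nowhere otherwise; hence they are almost equal iff the guess is wrong.
Equivalent positions are therefore almost equal in every column, and two inequivalent positions are
separated by a correct guess in which S is the class of one of them.

Effectivity rests on a step-bounded universal machine for [prog], run on codes built from the
pairing 2 ^ a * (2 b + 1), which is also the one underlying [pickle] on sequences. *)

Require Import Defs.
From mathcomp Require Import all_boot.
From mathcomp Require Import zify.
From Stdlib Require Import Classical.
Set Implicit Arguments. Unset Strict Implicit. Unset Printing Implicit Defensive.

(** * Computable functions *)

Definition computable (k : nat) (F : seq nat -> nat) : Prop :=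
  exists p, forall xs, size xs = k -> eval p xs [:: F xs].

Definition computables (k l : nat) (G : seq nat -> seq nat) : Prop :=
  exists p, forall xs, size xs = k -> size (G xs) = l /\ eval p xs (G xs).

(* No program outputs the empty list, so environments are kept nonempty: most closure lemmas
   below are stated for arity k.+1. *)
Create HintDb computable.
Hint Constants Opaque : computable.
Hint Variables Opaque : computable.

Lemma computable_ext k F G :
  (forall xs, size xs = k -> F xs = G xs) -> computable k F -> computable k G.
Proof. by move=> FG [p hp]; exists p => xs sx; rewrite -FG //; apply: hp. Qed.

Lemma computable_computables k l F G : computable l F -> computables k l G -> computable k (fun xs => F (G xs)).
Proof.
move=> [p hp] [q hq]; exists (PComp p q) => xs /hq[sG eG].
by apply: eComp eG _; apply: hp.
Qed.

Lemma computables_computables k l m F G :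
  computables l m F -> computables k l G -> computables k m (fun xs => F (G xs)).
Proof.
move=> [p hp] [q hq]; exists (PComp p q) => xs /hq[sG eG].
by have [sF eF] := hp _ sG; split=> //; apply: eComp eG _.
Qed.

Lemma computables1 k F : computable k F -> computables k 1 (fun xs => [:: F xs]).
Proof. by move=> [p hp]; exists p => xs /hp. Qed.

Lemma computables_cons k l F G :
  computable k F -> computables k l G -> computables k l.+1 (fun xs => F xs :: G xs).
Proof.
move=> [p hp] [q hq]; exists (PPair p q) => xs sx; have [<- eG] := hq _ sx.
by split=> //; apply: (ePair (hp _ sx) eG).
Qed.

Lemma computable_nth k i : computable k (fun xs => nth 0 xs i).
Proof. by exists (PProj i) => xs _; apply: eProj. Qed.

Lemma computable_head k : computable k (fun xs => head 0 xs).
Proof. by apply: computable_ext (computable_nth k 0) => xs _; rewrite nth0. Qed.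

(** [PProj] returns a single entry, so a tail of the environment is reassembled entry by entry with
    [PPair]; the induction is on the number of entries left, with d free. *)
Lemma computables_drop d k : computables (d + k.+1) k.+1 (drop d).
Proof.
elim: k d => [|k IHk] d.
  have [p hp] := computables1 (computable_nth (d + 1) d).
  exists p => xs sx; rewrite (drop_nth 0) ?sx ?addn1 // drop_oversize ?sx ?addn1 //.
  by apply: hp.
have [p hp] := computables_cons (computable_nth (d.+1 + k.+1) d) (IHk d.+1).
exists p => xs sx; rewrite (drop_nth 0) ?sx; last by lia.
by apply: hp; rewrite sx; lia.
Qed.

Lemma computables_id k : computables k.+1 k.+1 (fun xs => xs).
Proof.
have [p hp] := computables_drop 0 k.
by exists p => xs sx; have := hp _ sx; rewrite drop0.
Qed.

Lemma computables_behead k l G : computables k l.+2 G -> computables k l.+1 (fun xs => behead (G xs)).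
Proof.
apply: computables_computables; have [p hp] := computables_drop 1 l.
by exists p => xs sx; rewrite -drop1; apply: hp.
Qed.

Lemma computable_head_computables k l G : computables k l G -> computable k (fun xs => head 0 (G xs)).
Proof. exact: computable_computables (computable_head l). Qed.

Lemma computable_nth_computables k l G i :
  computables k l G -> computable k (fun xs => nth 0 (G xs) i).
Proof. exact: computable_computables (computable_nth l i). Qed.

Lemma computable_const k c : computable k (fun=> c).
Proof.
elim: c => [|c [p hp]]; first by exists PZero => xs _; apply: eZero.
by exists (PComp PSucc p) => xs /hp e; apply: eComp e (eSucc _).
Qed.

Lemma computable_succ k F : computable k F -> computable k (fun xs => (F xs).+1).
Proof.
by move=> [p hp]; exists (PComp PSucc p) => xs /hp e; apply: eComp e (eSucc _).
Qed.

(** [PRec] runs its step program on the counter, the previous value and the parameters, in this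
    order. This is why v has two more entries than xs and the parameters are read as
    [behead (behead v)]. *)
Lemma computable_iteri k N (G : seq nat -> nat -> nat -> nat) A :
  computable k.+1 N -> computable k.+1 A ->
  computable k.+3 (fun v => G (behead (behead v)) (head 0 v) (head 0 (behead v))) ->
  computable k.+1 (fun xs => iteri (N xs) (G xs) (A xs)).
Proof.
move=> cN [pa ha] [pg hg]; have [q hq] := computables_cons cN (computables_id k).
exists (PComp (PRec pa pg) q) => xs sx; have [_ eq] := hq _ sx.
apply: eComp eq _; elim: (N xs) => [|n IHn]; first exact/eRec0/ha.
by apply: (eRecS IHn); apply: (hg (n :: _ :: xs)); rewrite /= sx.
Qed.

Lemma computable_iter k N (G : seq nat -> nat -> nat) A :
  computable k.+1 N -> computable k.+1 A ->
  computable k.+3 (fun v => G (behead (behead v)) (head 0 (behead v))) ->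
  computable k.+1 (fun xs => iter (N xs) (G xs) (A xs)).
Proof.
move=> cN cA cG.
apply: computable_ext (computable_iteri (G := fun xs _ => G xs) cN cA cG) => xs _.
by elim: (N xs) => //= n ->.
Qed.

Hint Resolve computable_head_computables computables_behead computables_id computable_succ
  computable_nth_computables : computable.
Hint Extern 1 (computable _ (fun _ => ?c)) => apply (computable_const _ c) : computable.
Hint Extern 0 (computable _ _) => assumption : computable.
Hint Extern 2 (computable _ (fun v => ?a (@?g v))) =>
  match goal with H : computable _ a |- _ => apply (computable_computables H) end : computable.

Ltac comp_auto := eauto 100 with computable nocore.

Lemma computable_pred k F : computable k.+1 F -> computable k.+1 (fun xs => (F xs).-1).
Proof.
move=> cF.
have : computable k.+1 (fun xs => iteri (F xs) (fun i r => i) 0).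
  by apply: computable_iteri; comp_auto.
by apply: computable_ext => xs _; case: (F xs).
Qed.
Hint Resolve computable_pred : computable.

Lemma computable_add k F G :
  computable k.+1 F -> computable k.+1 G -> computable k.+1 (fun xs => F xs + G xs).
Proof.
move=> cF cG; have : computable k.+1 (fun xs => iter (F xs) succn (G xs)).
  by apply: computable_iter; comp_auto.
by apply: computable_ext => xs _; elim: (F xs) => //= n ->.
Qed.
Hint Resolve computable_add : computable.

Lemma computable_sub k F G :
  computable k.+1 F -> computable k.+1 G -> computable k.+1 (fun xs => F xs - G xs).
Proof.
move=> cF cG; have : computable k.+1 (fun xs => iter (G xs) predn (F xs)).
  by apply: computable_iter; comp_auto.
by apply: computable_ext => xs _; elim: (G xs) => [|n /= ->]; rewrite ?subn0 ?subnS.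
Qed.
Hint Resolve computable_sub : computable.

Lemma computable_mul k F G :
  computable k.+1 F -> computable k.+1 G -> computable k.+1 (fun xs => F xs * G xs).
Proof.
move=> cF cG; have : computable k.+1 (fun xs => iter (F xs) (addn (G xs)) 0).
  by apply: computable_iter; comp_auto.
by apply: computable_ext => xs _; elim: (F xs) => [|n /= ->]; rewrite ?mul0n ?mulSn.
Qed.
Hint Resolve computable_mul : computable.

Lemma computable_double k F : computable k.+1 F -> computable k.+1 (fun xs => (F xs).*2).
Proof.
move=> cF; have : computable k.+1 (fun xs => F xs + F xs) by comp_auto.
by apply: computable_ext => xs _; rewrite addnn.
Qed.
Hint Resolve computable_double : computable.

Lemma computable_exp2 k F : computable k.+1 F -> computable k.+1 (fun xs => 2 ^ F xs).
Proof.
move=> cF; have : computable k.+1 (fun xs => iter (F xs) double 1).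
  by apply: computable_iter; comp_auto.
by apply: computable_ext => xs _; elim: (F xs) => //= n ->; rewrite expnS mul2n.
Qed.
Hint Resolve computable_exp2 : computable.

Lemma computable_half k F : computable k.+1 F -> computable k.+1 (fun xs => (F xs)./2).
Proof.
move=> cF; have : computable k.+1 (fun xs => iteri (F xs) (fun i r => i - r) 0).
  by apply: computable_iteri; comp_auto.
by apply: computable_ext => xs _; elim: (F xs) => //= n ->; lia.
Qed.
Hint Resolve computable_half : computable.

Lemma computable_odd k F : computable k.+1 F -> computable k.+1 (fun xs => nat_of_bool (odd (F xs))).
Proof.
move=> cF; have : computable k.+1 (fun xs => F xs - (F xs)./2.*2) by comp_auto.
by apply: computable_ext => xs _; rewrite -{1}[F xs]odd_double_half addnK.
Qed.
Hint Resolve computable_odd : computable.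

Lemma computable_neg k (b : seq nat -> bool) :
  computable k.+1 (fun xs => nat_of_bool (b xs)) -> computable k.+1 (fun xs => nat_of_bool (~~ b xs)).
Proof.
move=> cb; have : computable k.+1 (fun xs => 1 - nat_of_bool (b xs)) by comp_auto.
by apply: computable_ext => xs _; case: (b xs).
Qed.
Hint Resolve computable_neg : computable.

Lemma computable_and k (b c : seq nat -> bool) :
  computable k.+1 (fun xs => nat_of_bool (b xs)) -> computable k.+1 (fun xs => nat_of_bool (c xs)) ->
  computable k.+1 (fun xs => nat_of_bool (b xs && c xs)).
Proof.
move=> cb cc; have : computable k.+1 (fun xs => nat_of_bool (b xs) * nat_of_bool (c xs)) by comp_auto.
by apply: computable_ext => xs _; case: (b xs); case: (c xs).
Qed.
Hint Resolve computable_and : computable.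

Lemma computable_or k (b c : seq nat -> bool) :
  computable k.+1 (fun xs => nat_of_bool (b xs)) -> computable k.+1 (fun xs => nat_of_bool (c xs)) ->
  computable k.+1 (fun xs => nat_of_bool (b xs || c xs)).
Proof.
move=> cb cc; have : computable k.+1 (fun xs => nat_of_bool (~~ (~~ b xs && ~~ c xs))) by comp_auto.
by apply: computable_ext => xs _; case: (b xs); case: (c xs).
Qed.
Hint Resolve computable_or : computable.

Lemma computable_implb k (b c : seq nat -> bool) :
  computable k.+1 (fun xs => nat_of_bool (b xs)) -> computable k.+1 (fun xs => nat_of_bool (c xs)) ->
  computable k.+1 (fun xs => nat_of_bool (b xs ==> c xs)).
Proof.
move=> cb cc; have : computable k.+1 (fun xs => nat_of_bool (~~ b xs || c xs)) by comp_auto.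
by apply: computable_ext => xs _; case: (b xs); case: (c xs).
Qed.
Hint Resolve computable_implb : computable.

Lemma computable_if k (b : seq nat -> bool) F G :
  computable k.+1 (fun xs => nat_of_bool (b xs)) -> computable k.+1 F -> computable k.+1 G ->
  computable k.+1 (fun xs => if b xs then F xs else G xs).
Proof.
move=> cb cF cG.
have : computable k.+1 (fun xs => nat_of_bool (b xs) * F xs + nat_of_bool (~~ b xs) * G xs).
  by comp_auto.
by apply: computable_ext => xs _; case: (b xs); rewrite /= ?mul1n ?mul0n ?addn0.
Qed.
Hint Resolve computable_if : computable.

Lemma computable_eq k F G :
  computable k.+1 F -> computable k.+1 G -> computable k.+1 (fun xs => nat_of_bool (F xs == G xs)).
Proof.
move=> cF cG.
have : computable k.+1 (fun xs => 1 - ((F xs - G xs) + (G xs - F xs))) by comp_auto.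
by apply: computable_ext => xs _; case: eqP => /=; lia.
Qed.
Hint Resolve computable_eq : computable.

Lemma computable_leq k F G :
  computable k.+1 F -> computable k.+1 G -> computable k.+1 (fun xs => nat_of_bool (F xs <= G xs)).
Proof.
move=> cF cG; have : computable k.+1 (fun xs => nat_of_bool (F xs - G xs == 0)) by comp_auto.
by apply: computable_ext => xs _; rewrite subn_eq0.
Qed.
Hint Resolve computable_leq : computable.

Lemma computable_has k N (P : seq nat -> nat -> bool) :
  computable k.+1 N ->
  computable k.+3 (fun v => nat_of_bool (P (behead (behead v)) (head 0 v))) ->
  computable k.+1 (fun xs => nat_of_bool (has (P xs) (iota 0 (N xs)))).
Proof.
move=> cN cP.
have : computable k.+1 (fun xs => iteri (N xs) (fun i r => if P xs i then 1 else r) 0).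
  by apply: computable_iteri; comp_auto.
apply: computable_ext => xs _; elim: (N xs) => // n IHn.
rewrite [LHS]/= {}IHn -[in RHS]addn1 iotaD has_cat has_seq1 add0n.
by case: (P xs n); rewrite ?orbT ?orbF.
Qed.

Lemma computable_all k N (P : seq nat -> nat -> bool) :
  computable k.+1 N ->
  computable k.+3 (fun v => nat_of_bool (P (behead (behead v)) (head 0 v))) ->
  computable k.+1 (fun xs => nat_of_bool (all (P xs) (iota 0 (N xs)))).
Proof.
move=> cN cP; have := computable_has (P := fun xs i => ~~ P xs i) cN (computable_neg cP).
move/computable_neg; apply: computable_ext => xs _.
by rewrite -all_predC; congr nat_of_bool; apply: eq_all => i /=; rewrite negbK.
Qed.

(* Every n > 0 is lcons (lcar n) (lcdr n); lcar and lcdr send 0 to 0. *)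
Definition lcons a b := 2 ^ a * b.*2.+1.
Definition lcar n := iter n (fun c => if odd (iter c half n) then c else c.+1) 0.
Definition lcdr n := (iter (lcar n) half n)./2.

Lemma computable_lcons k F G :
  computable k.+1 F -> computable k.+1 G -> computable k.+1 (fun xs => lcons (F xs) (G xs)).
Proof. by move=> cF cG; rewrite /lcons; comp_auto. Qed.

Lemma computable_lcar k F : computable k.+1 F -> computable k.+1 (fun xs => lcar (F xs)).
Proof.
move=> cF; rewrite /lcar; apply: computable_iter; comp_auto.
apply: computable_if; comp_auto; apply: computable_odd; apply: computable_iter; comp_auto.
Qed.
Hint Resolve computable_lcons computable_lcar : computable.

Lemma computable_lcdr k F : computable k.+1 F -> computable k.+1 (fun xs => lcdr (F xs)).
Proof.
by move=> cF; rewrite /lcdr; apply: computable_half; apply: computable_iter; comp_auto.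
Qed.
Hint Resolve computable_lcdr : computable.

Lemma iter_half_mul c m : iter c half (2 ^ c * m) = m.
Proof.
by elim: c => [|c IHc]; rewrite ?mul1n // iterSr expnS -mulnA mul2n doubleK.
Qed.

(** The counter in [lcar] grows as long as that many halvings leave an even number, so it stops at
    the exponent a of 2. The n rounds suffice because a < 2 ^ a <= n. *)
Lemma lconsK1 a b : lcar (lcons a b) = a.
Proof.
rewrite /lcar; set n := lcons a b; set f := fun c => _.
have fE c : c <= a -> f c = if c == a then a else c.+1.
  move=> ca; rewrite /f; have [->|ne] := eqVneq c a.
    by rewrite iter_half_mul /= odd_double.
  have -> : n = 2 ^ c * (2 ^ (a - c) * b.*2.+1) by rewrite mulnA -expnD subnKC.
  by rewrite iter_half_mul oddM oddX /= subn_eq0 leqNgt ltn_neqAle ne ca.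
have iE m : iter m f 0 = minn m a.
  elim: m => [|m IHm]; first by rewrite min0n.
  by rewrite iterS IHm fE ?geq_minr //; case: eqP; lia.
rewrite iE; apply/minn_idPr; apply: leq_trans (_ : 2 ^ a <= _).
  exact/ltnW/ltn_expl.
by rewrite leq_pmulr.
Qed.

Lemma lconsK2 a b : lcdr (lcons a b) = b.
Proof. by rewrite /lcdr lconsK1 iter_half_mul /= uphalf_double. Qed.

Lemma lcons_gt0 a b : 0 < lcons a b.
Proof. by rewrite /lcons muln_gt0 expn_gt0. Qed.

Lemma lcons_eq0 a b : (lcons a b == 0) = false.
Proof. exact/negbTE/(lt0n_neq0 (lcons_gt0 a b)). Qed.

Lemma leq_lcons a b c d : a <= c -> b <= d -> lcons a b <= lcons c d.
Proof. by move=> ac bd; rewrite leq_mul ?leq_pexp2l ?ltnS ?leq_double. Qed.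

Lemma gt_lcons_l a b : a < lcons a b.
Proof. by apply: leq_trans (ltn_expl a (ltnSn 1)) _; rewrite leq_pmulr. Qed.

Lemma gt_lcons_r a b : b < lcons a b.
Proof.
apply: (leq_trans _ (leq_lcons (leq0n a) (leqnn b))).
by rewrite /lcons mul1n ltnS -addnn leq_addr.
Qed.

Lemma lcar0 : lcar 0 = 0. Proof. by []. Qed.
Lemma lcdr0 : lcdr 0 = 0. Proof. by []. Qed.

(** * Lists coded by iterated pairs *)

Definition lcode := foldr lcons 0.

Lemma lcodeE s : CodeSeq.code s = lcode s. Proof. by []. Qed.

Lemma lcode_cons x s : lcode (x :: s) = lcons x (lcode s). Proof. by []. Qed.

Lemma lcode_surj n : exists s, n = lcode s.
Proof. by exists (CodeSeq.decode n); rewrite -lcodeE CodeSeq.decodeK. Qed.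

Lemma lcode_eq0 s : (lcode s == 0) = nilp s.
Proof. by case: s => //= x s; rewrite lcons_eq0. Qed.

Opaque lcons lcar lcdr.
Arguments lcode : simpl never.

Definition lE := (lconsK1, lconsK2, lcons_eq0, lcar0, lcdr0).

Lemma lcar_code s : lcar (lcode s) = head 0 s.
Proof. by case: s => // x s; rewrite lcode_cons lE. Qed.

Lemma lcdr_code s : lcdr (lcode s) = lcode (behead s).
Proof. by case: s => // x s; rewrite lcode_cons lE. Qed.

Definition ldrop i l := iter i lcdr l.
Definition lnth l i := lcar (ldrop i l).
(** Nonempty lists have nonzero codes, so the counter stops at the first empty tail; l rounds
    suffice since a list is no longer than its code. *)
Definition lsize l := iter l (fun c => if ldrop c l == 0 then c else c.+1) 0.

Lemma ldrop_code i s : ldrop i (lcode s) = lcode (drop i s).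
Proof.
elim: i => [|i IHi]; rewrite /ldrop /= ?drop0 // -/(ldrop _ _) IHi lcdr_code.
by rewrite -drop1 drop_drop add1n.
Qed.

Lemma lnth_code s i : lnth (lcode s) i = nth 0 s i.
Proof. by rewrite /lnth ldrop_code lcar_code -nth0 nth_drop addn0. Qed.

Lemma ldrop_eq0 i s : (ldrop i (lcode s) == 0) = (size s <= i).
Proof. by rewrite ldrop_code lcode_eq0 /nilp size_drop subn_eq0. Qed.

Lemma leq_size_lcode s : size s <= lcode s.
Proof.
by elim: s => // x s IHs; apply: leq_ltn_trans IHs (gt_lcons_r _ _).
Qed.

Lemma lsize_code s : lsize (lcode s) = size s.
Proof.
rewrite /lsize; set f := fun c => _.
have iE m : iter m f 0 = minn m (size s).
  elim: m => [|m IHm]; first by rewrite min0n.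
  by rewrite iterS IHm /f ldrop_eq0; case: leqP; lia.
by rewrite iE; apply/minn_idPr/leq_size_lcode.
Qed.

Lemma computable_ldrop k F G :
  computable k.+1 F -> computable k.+1 G -> computable k.+1 (fun xs => ldrop (F xs) (G xs)).
Proof. by move=> cF cG; rewrite /ldrop; apply: computable_iter; comp_auto. Qed.
Hint Resolve computable_ldrop : computable.

Lemma computable_lnth k F G :
  computable k.+1 F -> computable k.+1 G -> computable k.+1 (fun xs => lnth (F xs) (G xs)).
Proof. by move=> cF cG; rewrite /lnth; comp_auto. Qed.

Lemma computable_lsize k F : computable k.+1 F -> computable k.+1 (fun xs => lsize (F xs)).
Proof. by move=> cF; rewrite /lsize; apply: computable_iter; comp_auto. Qed.
Hint Resolve computable_lnth computable_lsize : computable.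

(** A right fold consumes the list from its end, so round i reads the position i + 1 places before
    the end. *)
Definition lfoldr (f : nat -> nat -> nat) a l :=
  iteri (lsize l) (fun i r => f (lnth l (lsize l - i.+1)) r) a.

Lemma eq_in_iteri n (f g : nat -> nat -> nat) a :
  (forall i r, i < n -> f i r = g i r) -> iteri n f a = iteri n g a.
Proof.
elim: n => //= n IHn fg; rewrite fg // IHn // => i r lin.
by apply: fg; apply: ltnW.
Qed.

Lemma lfoldr_code f a s : lfoldr f a (lcode s) = foldr f a s.
Proof.
rewrite /lfoldr lsize_code; elim: s => //= x s IHs; rewrite subnn.
rewrite lnth_code /= -IHs; congr f.
by apply: eq_in_iteri => i r li; rewrite !lnth_code subSn.
Qed.

Lemma computable_lfoldr k (f : seq nat -> nat -> nat -> nat) A L :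
  computable k.+1 L -> computable k.+1 A ->
  computable k.+3 (fun v => f (behead (behead v))
    (lnth (L (behead (behead v))) (lsize (L (behead (behead v))) - (head 0 v).+1))
    (head 0 (behead v))) ->
  computable k.+1 (fun xs => lfoldr (f xs) (A xs) (L xs)).
Proof. by move=> cL cA cf; rewrite /lfoldr; apply: computable_iteri; comp_auto. Qed.

Definition lapp l1 l2 := lfoldr lcons l2 l1.

Lemma lapp_code s t : lapp (lcode s) (lcode t) = lcode (s ++ t).
Proof. by rewrite /lapp lfoldr_code /lcode foldr_cat. Qed.

Lemma computable_lapp k F G :
  computable k.+1 F -> computable k.+1 G -> computable k.+1 (fun xs => lapp (F xs) (G xs)).
Proof. by move=> cF cG; rewrite /lapp; apply: computable_lfoldr; comp_auto. Qed.
Hint Resolve computable_lapp : computable.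

Definition ltab (f : nat -> nat) n := iteri n (fun i r => lcons (f (n - i.+1)) r) 0.

Lemma ltabE f n : ltab f n = lcode (mkseq f n).
Proof.
rewrite -[RHS](lfoldr_code lcons 0) /lfoldr lsize_code size_mkseq.
by apply: eq_in_iteri => i r li; rewrite lnth_code nth_mkseq //; lia.
Qed.

(** The Cantor pairing runs along each antidiagonal from (n, 0) to (0, n) and then passes to (n + 1,
    0). Hence w such moves from (0, 0) invert it at w. *)
Definition cpair_next st :=
  if lcar st == 0 then lcons (lcdr st).+1 0 else lcons (lcar st).-1 (lcdr st).+1.
Definition cunpair w := iter w cpair_next (lcons 0 0).

Lemma computable_cunpair k F : computable k.+1 F -> computable k.+1 (fun xs => cunpair (F xs)).
Proof.
by move=> cF; rewrite /cunpair /cpair_next; apply: computable_iter; comp_auto.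
Qed.
Hint Resolve computable_cunpair : computable.

Lemma cpairS0 y : cpair y.+1 0 = (cpair 0 y).+1.
Proof. by rewrite /cpair !addn0 add0n !addn1 binS bin1 addnS. Qed.

Lemma cpairSS x y : cpair x y.+1 = (cpair x.+1 y).+1.
Proof. by rewrite /cpair !addnS addSn. Qed.

Lemma cunpairK x y : cunpair (cpair x y) = lcons x y.
Proof.
(* The outer induction is on the antidiagonal, the inner one on the place y in it. *)
elim: {x y}(x + y) {-2}x {-2}y (erefl (x + y)) => [|n IHn] x y.
  by case: x => //; case: y => // _; rewrite /cunpair /= .
elim: y x => [|y IHy] x.
  rewrite addn0 => ->; rewrite cpairS0 /cunpair iterS -/(cunpair _) IHn //.
  by rewrite /cpair_next !lE.
rewrite addnS => -[xy]; rewrite cpairSS /cunpair iterS -/(cunpair _) IHy ?addSn ?xy //.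
by rewrite /cpair_next !lE.
Qed.

Lemma computable_cpair k F G :
  computable k.+1 F -> computable k.+1 G -> computable k.+1 (fun xs => cpair (F xs) (G xs)).
Proof.
move=> cF cG.
have : computable k.+1 (fun xs => ((F xs + G xs + 1) * (F xs + G xs + 1).-1)./2 + G xs).
  by comp_auto.
by apply: computable_ext => xs _; rewrite /cpair bin2.
Qed.
Hint Resolve computable_cpair : computable.

(** * Decoding of program indices *)

(** Tags start at 1, so that a nonzero [lcar] tells a program from a leaf (tag 0) and from the
    failure code 0. *)
Fixpoint pcode (p : prog) : nat :=
  match p with
  | PZero => lcons 1 0
  | PSucc => lcons 2 0
  | PProj i => lcons 3 i
  | PComp f g => lcons 4 (lcons (pcode f) (pcode g))
  | PPair f g => lcons 5 (lcons (pcode f) (pcode g))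
  | PRec f g => lcons 6 (lcons (pcode f) (pcode g))
  | PMu f => lcons 7 (pcode f)
  end.

(* Leaves are kept apart (tag 0) although they do not decode, as PProj needs their labels; nodes
   that do not decode have code 0. *)
Definition tree_code (t : GenTree.tree nat) : nat :=
  match t with
  | GenTree.Leaf i => lcons 0 i
  | GenTree.Node _ _ => oapp pcode 0 (decode t)
  end.

(** One level of [decode], computed from the codes of the children. Arity is checked by emptiness of
    tails, and a child decodes iff [lcar] of its code is nonzero; only label 2 asks for a leaf. *)
Definition lnode n l :=
  if (n == 0) || (n == 1) then if l == 0 then lcons n.+1 0 else 0 else
  if l == 0 then 0 else
  if n == 2 then
    if (lcdr l == 0) && (lcar l != 0) && (lcar (lcar l) == 0)
    then lcons 3 (lcdr (lcar l)) else 0 else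
  if n == 6 then
    if (lcdr l == 0) && (lcar (lcar l) != 0) then lcons 7 (lcar l) else 0 else
  if n <= 5 then
    if (lcdr l != 0) && (lcdr (lcdr l) == 0)
       && (lcar (lcar l) != 0) && (lcar (lcar (lcdr l)) != 0)
    then lcons n.+1 (lcons (lcar l) (lcar (lcdr l))) else 0
  else 0.

Lemma computable_lnode k F G :
  computable k.+1 F -> computable k.+1 G -> computable k.+1 (fun xs => lnode (F xs) (G xs)).
Proof. by move=> cF cG; rewrite /lnode; comp_auto. Qed.
Hint Resolve computable_lnode : computable.

Lemma lcar_pcode p : (lcar (pcode p) == 0) = false.
Proof. by case: p => * /=; rewrite lE. Qed.

Lemma pcode_eq0 p : (pcode p == 0) = false.
Proof. by case: p => * /=; rewrite lE. Qed.

Lemma tree_code_valid t :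
  (lcar (tree_code t) == 0) = ~~ isSome (decode t).
Proof.
case: t => [i|n l]; first by rewrite /= lE.
by rewrite /tree_code; case: (decode _) => [p|] /=; rewrite ?lcar_pcode ?lE.
Qed.

Lemma tree_code_some t p : decode t = Some p -> tree_code t = pcode p.
Proof. by case: t => [//|n l]; rewrite /tree_code => ->. Qed.

Lemma tree_code_node n l :
  tree_code (GenTree.Node n l) = lnode n (lcode (map tree_code l)).
Proof.
have C a b u v : decode a = u -> decode b = v ->
  (lcar (tree_code a) != 0) && (lcar (tree_code b) != 0) = isSome u && isSome v.
  by move=> <- <-; rewrite !tree_code_valid !negbK.
rewrite /lnode; case: l => [|a [|b [|c l]]].
- by case: n => [|[|[|[|[|[|[|n]]]]]]].
- rewrite /= !lcode_cons !lE /=; move: n => [|[|[|[|[|[|[|n]]]]]]] //=.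
    case: a => [i|n l]; first by rewrite !lE.
    rewrite /tree_code; case: (decode _) => [p|] //=.
    by rewrite pcode_eq0 lcar_pcode.
  rewrite tree_code_valid negbK; case E: (decode a) => [p|] //=.
  by rewrite (tree_code_some E).
- rewrite /= !lcode_cons !lE /=.
  move: n => [|[|[|[|[|[|[|n]]]]]]] //=; try (by case: (a));
  by rewrite ?(C a b _ _ erefl erefl); case E: (decode a) => [p|] //=;
     case E': (decode b) => [q|] //=; rewrite (tree_code_some E) (tree_code_some E').
rewrite /= !lcode_cons !lE /=.
by move: n => [|[|[|[|[|[|[|n]]]]]]] //=; case: (a).
Qed.

Arguments tree_code : simpl never.

(* [GenTree.decode_step] on codes; items that fail to unpickle leave the state unchanged, which
   matches the [pmap] in the unpickling of sequences. *)
Definition lstep c st :=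
  if (c == 0) || (lcdr c == 0) || (lcdr (lcdr c) != 0) then st else
  if lcar (lcdr c) != 0 then
    lcons (lcons (lcons 0 (lcar (lcar (lcdr c)))) (lcar st)) (lcdr st) else
  if lcar c == 0 then st else
  if lcar (lcar c) == 0 then lcons 0 (lcons (lcar st) (lcdr st)) else
  lcons (lcons (lnode (lcar (lcar c)).-1 (lcar st)) (lcar (lcdr st))) (lcdr (lcdr st)).

Lemma computable_lstep k F G :
  computable k.+1 F -> computable k.+1 G -> computable k.+1 (fun xs => lstep (F xs) (G xs)).
Proof. by move=> cF cG; rewrite /lstep; comp_auto. Qed.
Hint Resolve computable_lstep : computable.

(** In the final stack the inner [lcar] selects the current list of trees, the outer one its first
    tree. *)
Definition lprog e := lcar (lcar (lfoldr lstep (lcons 0 0) e)).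

Lemma computable_lprog k F : computable k.+1 F -> computable k.+1 (fun xs => lprog (F xs)).
Proof. by move=> cF; rewrite /lprog; do 2!apply: computable_lcar; apply: computable_lfoldr; comp_auto. Qed.
Hint Resolve computable_lprog : computable.

Definition stack_code (fs : seq (GenTree.tree nat) * seq (seq (GenTree.tree nat))) :=
  lcons (lcode (map tree_code fs.1)) (lcode (map (lcode \o map tree_code) fs.2)).

(** A sum is pickled as a pair of options, a pair as a list of two entries, and an option as a list
    of length at most 1, so 0 stands for [None]. When both options are present the right one
    wins. *)
Lemma unpickle_sumE s : unpickle (lcode s) =
  if s is [:: a; b] then
    if b != 0 then Some (inr (lcar b))
    else if a != 0 then Some (inl (lcar a)) else None
  else None :> option (nat + nat).
Proof.
have -> : unpickle (lcode s) = obind sum_of_opair (omap pair_of_tag (@unpickle_tagged (option nat : countType) (fun=> option nat : countType) (lcode s)))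
   :> option (nat + nat).
  by [].
rewrite /unpickle_tagged -lcodeE CodeSeq.codeK; case: s => [|a [|b [|]]] //.
have [s ->] := lcode_surj a; have [t ->] := lcode_surj b.
rewrite !lcode_eq0 !lcar_code.
have U r : unpickle (lcode r) = Some (ohead r) :> option (option nat).
  have -> : unpickle (lcode r) = Some (ohead (pmap Some (CodeSeq.decode (lcode r)))) :> option (option nat).
    by [].
  by rewrite -lcodeE CodeSeq.codeK; case: r.
by rewrite !U /=; case: s t => [|x s] [|y t].
Qed.


Lemma lstep_code s (fs : seq (GenTree.tree nat) * seq (seq (GenTree.tree nat))) :
  lstep (lcode s) (stack_code fs) =
  stack_code (oapp (fun c => GenTree.decode_step c fs) fs
                   (unpickle (lcode s) : option (nat + nat))).
Proof.
rewrite unpickle_sumE /lstep; case: s => [|a [|b [|c s]]] //;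
  rewrite ?lcode_cons ?lE //= ?lcode_eq0 //=.
case: eqVneq => //= _; case: eqVneq => //= _; rewrite /stack_code.
case: (lcar a) => [|n] /=; first by [].
by rewrite tree_code_node lcar_code lcdr_code; case: fs => ts [|us uss].
Qed.

Lemma lprogE e :
  lprog e = oapp tree_code 0 (unpickle e : option (GenTree.tree nat)).
Proof.
have [s ->] := lcode_surj e.
have -> : unpickle (lcode s) = obind (@GenTree.decode nat)
   (Some (pmap unpickle (CodeSeq.decode (lcode s)))) :> option (GenTree.tree nat).
  by [].
rewrite -lcodeE CodeSeq.codeK lcodeE /lprog lfoldr_code /= /GenTree.decode.
have -> : lcons 0 0 = stack_code ([::], [::]) by [].
have -> : foldr lstep (stack_code ([::], [::])) s =
  stack_code (foldr (@GenTree.decode_step nat) ([::], [::]) (pmap unpickle s)).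
  elim: s => //= x s ->; have [r ->] := lcode_surj x.
  by rewrite lstep_code; case: (unpickle _).
by rewrite /stack_code lE lcar_code; case: (foldr _ _ _) => -[].
Qed.

Lemma lprog_prog_of_nat e :
  if prog_of_nat e is Some p then lprog e = pcode p else lcar (lprog e) = 0.
Proof.
rewrite lprogE /prog_of_nat; case: (unpickle e : option _) => [t|] //=.
case E: (decode t) => [p|]; first exact: tree_code_some.
by apply/eqP; rewrite tree_code_valid E.
Qed.

(** * The step-bounded universal machine *)

Section EvalInduction.

Variable P : prog -> seq nat -> seq nat -> Prop.
Hypothesis HZero : forall xs, P PZero xs [:: 0].
Hypothesis HSucc : forall xs, P PSucc xs [:: (head 0 xs).+1].
Hypothesis HProj : forall i xs, P (PProj i) xs [:: nth 0 xs i].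
Hypothesis HComp : forall f g xs ys zs, P g xs ys -> P f ys zs -> P (PComp f g) xs zs.
Hypothesis HPair : forall f g xs ys zs,
  P f xs ys -> P g xs zs -> P (PPair f g) xs (ys ++ zs).
Hypothesis HRec0 : forall f g ys zs, P f ys zs -> P (PRec f g) (0 :: ys) zs.
Hypothesis HRecS : forall f g n ys r zs,
  P (PRec f g) (n :: ys) r -> P g (n :: r ++ ys) zs -> P (PRec f g) (n.+1 :: ys) zs.
Hypothesis HMu : forall f xs n,
  (forall m, m < n -> exists ys, P f (m :: xs) ys /\ head 0 ys <> 0) ->
  (exists ys, P f (n :: xs) ys /\ head 0 ys = 0) -> P (PMu f) xs [:: n].

(* The automatic scheme gives no induction hypotheses under the existentials of eMu. *)
Fixpoint eval_nested_ind p xs ys (e : eval p xs ys) : P p xs ys :=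
  match e with
  | eZero xs => HZero xs
  | eSucc xs => HSucc xs
  | eProj i xs => HProj i xs
  | eComp _ _ _ _ _ e1 e2 => HComp (eval_nested_ind e1) (eval_nested_ind e2)
  | ePair _ _ _ _ _ e1 e2 => HPair (eval_nested_ind e1) (eval_nested_ind e2)
  | eRec0 _ g _ _ e1 => HRec0 g (eval_nested_ind e1)
  | eRecS _ _ _ _ _ _ e1 e2 => HRecS (eval_nested_ind e1) (eval_nested_ind e2)
  | eMu _ _ _ h1 h2 =>
      HMu (fun m lt_m_n => let: ex_intro ys (conj e1 nz) := h1 m lt_m_n in
             ex_intro _ ys (conj (eval_nested_ind e1) nz))
          (let: ex_intro ys (conj e1 z) := h2 in
             ex_intro _ ys (conj (eval_nested_ind e1) z))
  end.

End EvalInduction.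

(** The machine keeps pending work on a stack of frames, so that [step] makes no recursive call and
    can be copied on codes by a case analysis. *)
Inductive frame :=
| KComp (f : prog)
| KPair1 (g : prog) (xs : seq nat)
| KPair2 (ys : seq nat)
| KRec (g : prog) (n : nat) (ys : seq nat)
| KMu (f : prog) (n : nat) (xs : seq nat).

Inductive config :=
| Ev (p : prog) (xs : seq nat) (K : seq frame)
| Rt (ys : seq nat) (K : seq frame)
| Stuck.

Definition step (c : config) : config :=
  match c with
  | Ev PZero xs K => Rt [:: 0] K
  | Ev PSucc xs K => Rt [:: (head 0 xs).+1] K
  | Ev (PProj i) xs K => Rt [:: nth 0 xs i] K
  | Ev (PComp f g) xs K => Ev g xs (KComp f :: K)
  | Ev (PPair f g) xs K => Ev f xs (KPair1 g xs :: K)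
  | Ev (PRec f g) [::] K => Stuck
  | Ev (PRec f g) (0 :: ys) K => Ev f ys K
  | Ev (PRec f g) (n.+1 :: ys) K => Ev (PRec f g) (n :: ys) (KRec g n ys :: K)
  | Ev (PMu f) xs K => Ev f (0 :: xs) (KMu f 0 xs :: K)
  | Rt ys [::] => Rt ys [::]
  | Rt ys (KComp f :: K) => Ev f ys K
  | Rt ys (KPair1 g xs :: K) => Ev g xs (KPair2 ys :: K)
  | Rt zs (KPair2 ys :: K) => Rt (ys ++ zs) K
  | Rt r (KRec g n ys :: K) => Ev g (n :: r ++ ys) K
  | Rt ys (KMu f n xs :: K) =>
      if head 0 ys == 0 then Rt [:: n] K else Ev f (n.+1 :: xs) (KMu f n.+1 xs :: K)
  | Stuck => Stuck
  end.

Definition halted (c : config) : bool := if c is Rt _ [::] then true else false.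

Definition steps c c' := exists n, iter n step c = c'.

Lemma steps_trans c1 c2 c3 : steps c1 c2 -> steps c2 c3 -> steps c1 c3.
Proof. by move=> [n <-] [m <-]; exists (m + n); rewrite iterD. Qed.

Lemma steps1 c1 c2 : steps (step c1) c2 -> steps c1 c2.
Proof. by apply: steps_trans; exists 1. Qed.

Lemma eval_steps p xs ys : eval p xs ys -> forall K, steps (Ev p xs K) (Rt ys K).
Proof.
elim/eval_nested_ind => {p xs ys}.
- by move=> xs K; exists 1.
- by move=> xs K; exists 1.
- by move=> i xs K; exists 1.
- move=> f g xs ys zs IHg IHf K; apply: steps1 => /=.
  by apply: steps_trans (IHg _) _; apply: steps1; apply: IHf.
- move=> f g xs ys zs IHf IHg K; apply: steps1 => /=.
  apply: steps_trans (IHf _) _; apply: steps1; apply: steps_trans (IHg _) _.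
  by exists 1.
- by move=> f g ys zs IHf K; apply: steps1; apply: IHf.
- move=> f g n ys r zs IHf IHg K; apply: steps1 => /=.
  by apply: steps_trans (IHf _) _; apply: steps1; apply: IHg.
- move=> f xs n IHlt [ys [IHn y0]] K; apply: steps1 => /=.
  (* The candidates are tried in turn: each m < n returns a nonzero value, which leads on to m +
     1. *)
  have {IHlt} IH m : m <= n ->
      steps (Ev f (0 :: xs) (KMu f 0 xs :: K)) (Ev f (m :: xs) (KMu f m xs :: K)).
    elim: m => [|m IHm] lmn; first by exists 0.
    apply: steps_trans (IHm (ltnW lmn)) _; have [zs [IHz /eqP/negbTE nz]] := IHlt _ lmn.
    by apply: steps_trans (IHz _) _; exists 1; rewrite /= nz.
  apply: steps_trans (IH n (leqnn n)) _; apply: steps_trans (IHn _) _.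
  by exists 1; rewrite /= y0.
Qed.

Lemma iter_step_halted n c : halted c -> iter n step c = c.
Proof. by case: c => // ys [|k K] // _; elim: n => //= n ->. Qed.

Lemma halted_mono m n c : m <= n -> halted (iter m step c) -> halted (iter n step c).
Proof. by move=> lmn h; rewrite -(subnK lmn) iterD iter_step_halted. Qed.

(** Halted configurations are fixed by [step], so the configuration after m + n steps shows both
    outputs. *)
Lemma eval_det p xs ys zs : eval p xs ys -> eval p xs zs -> ys = zs.
Proof.
move=> /eval_steps/(_ [::])[m em] /eval_steps/(_ [::])[n en].
have := iter_step_halted n (isT : halted (Rt ys [::])).
have := iter_step_halted m (isT : halted (Rt zs [::])).
by rewrite -{1}em -{1}en -!iterD addnC => -> [].
Qed.

(** Strong induction on the length of the run: a run that halts with K below must first return a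
    value to K, and the bound m <= n leaves a shorter halting run for whatever comes next. *)
Lemma halted_eval n p xs K : halted (iter n step (Ev p xs K)) ->
  exists ys m, [/\ m <= n, eval p xs ys & iter m step (Ev p xs K) = Rt ys K].
Proof.
elim/ltn_ind: n p xs K => n IH p xs K.
case: n IH => [//|n] IH; rewrite iterSr.
have IH' k q zs L : k <= n -> halted (iter k step (Ev q zs L)) ->
    exists ys m, [/\ m <= k, eval q zs ys &
      halted (iter (k - m) step (Rt ys L)) /\ iter m step (Ev q zs L) = Rt ys L].
  move=> lk h; have [||ys [m [lm e r]]] := IH k _ q zs L; rewrite ?ltnS //.
  by exists ys, m; split=> //; split=> //; rewrite -r -iterD subnK.
have S k c : halted (iter k step c) -> ~~ halted c -> 0 < k /\ halted (iter k.-1 step (step c)).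
  by case: k => [-> //|k]; rewrite iterSr.
case: p => [||i|f g|f g|f g|f] /=.
- by move=> _; exists [:: 0], 1; split=> //; apply: eZero.
- by move=> _; exists [:: (head 0 xs).+1], 1; split=> //; apply: eSucc.
- by move=> _; exists [:: nth 0 xs i], 1; split=> //; apply: eProj.
- move=> /(IH' _ _ _ _ (leqnn n))[ys [m [lm e [h r]]]].
  have [/= lt0 h1] := S _ _ h isT.
  have [|zs [m' [lm' e' [_ r']]]] := IH' _ _ _ _ _ h1; first by lia.
  exists zs, (m' + (1 + (m + 1))); split; [lia|exact: eComp e e'|].
  by rewrite iterD iterD iterD /= r /= r'.
- move=> /(IH' _ _ _ _ (leqnn n))[ys [m [lm e [h r]]]].
  have [/= lt0 h1] := S _ _ h isT.
  have [|zs [m' [lm' e' [h2 r']]]] := IH' _ _ _ _ _ h1; first by lia.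
  have [/= lt0' _] := S _ _ h2 isT.
  exists (ys ++ zs), (1 + (m' + (1 + (m + 1)))); split; [lia|exact: ePair e e'|].
  by rewrite iterD iterD iterD iterD /= r /= r'.
- case: xs => [|[|k] xs].
  + by have -> : iter n step Stuck = Stuck by elim: (n) => //= ? ->.
  + move=> /(IH' _ _ _ _ (leqnn n))[ys [m [lm e [h r]]]].
    exists ys, m.+1; split; [lia|exact: eRec0|].
    by rewrite iterSr.
  move=> /(IH' _ _ _ _ (leqnn n))[ys [m [lm e [h r]]]].
  have [/= lt0 h1] := S _ _ h isT.
  have [|zs [m' [lm' e' [_ r']]]] := IH' _ _ _ _ _ h1; first by lia.
  exists zs, (m' + (1 + (m + 1))); split; [lia|exact: eRecS e e'|].
  by rewrite iterD iterD iterD /= r /= r'.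
(* The search needs an inner induction on the number k of steps left, at a candidate i below which
   all values are nonzero. *)
move=> h0; suff H k i : k <= n ->
    (forall m, m < i -> exists ys, eval f (m :: xs) ys /\ head 0 ys <> 0) ->
    halted (iter k step (Ev f (i :: xs) (KMu f i xs :: K))) ->
    exists j m, [/\ m <= k, eval (PMu f) xs [:: j] &
      iter m step (Ev f (i :: xs) (KMu f i xs :: K)) = Rt [:: j] K].
  have [//|j [m [lm e r]]] := H n 0 (leqnn n) _ h0.
  by exists [:: j], m.+1; rewrite iterSr.
elim/ltn_ind: k i => k IHk i lkn Hlt h.
have [ys [m [lm e [h1 r]]]] := IH' _ _ _ _ lkn h; have [/= lt0 h2] := S _ _ h1 isT.
move: h2; case: eqP => [y0 _|nz h2].
  exists i, (1 + m); split; [lia | by apply: eMu => //; exists ys | ].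
  by rewrite iterD r /= y0.
have [| | |j [m' [lm' e' r']]] := IHk _ _ i.+1 _ _ h2; [lia|lia| |].
  by move=> m'; rewrite ltnS leq_eqVlt => /orP[/eqP->|/Hlt//]; exists ys.
exists j, (m' + (1 + m)); split; [lia|by []|].
by rewrite iterD iterD r /= (introF eqP nz).
Qed.

Definition frame_code (k : frame) : nat :=
  match k with
  | KComp f => lcons 0 (pcode f)
  | KPair1 g xs => lcons 1 (lcons (pcode g) (lcode xs))
  | KPair2 ys => lcons 2 (lcode ys)
  | KRec g n ys => lcons 3 (lcons (pcode g) (lcons n (lcode ys)))
  | KMu f n xs => lcons 4 (lcons (pcode f) (lcons n (lcode xs)))
  end.

Definition config_code (c : config) : nat :=
  match c with
  | Ev p xs K => lcons 0 (lcons (pcode p) (lcons (lcode xs) (lcode (map frame_code K))))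
  | Rt ys K => lcons 1 (lcons (lcode ys) (lcode (map frame_code K)))
  | Stuck => 0
  end.

Definition lev p xs K := lcons 0 (lcons p (lcons xs K)).
Definition lrt ys K := lcons 1 (lcons ys K).

Definition lstep_ev p xs K :=
  if lcar p == 1 then lrt (lcons 0 0) K else
  if lcar p == 2 then lrt (lcons (lcar xs).+1 0) K else
  if lcar p == 3 then lrt (lcons (lnth xs (lcdr p)) 0) K else
  if lcar p == 4 then lev (lcdr (lcdr p)) xs (lcons (lcons 0 (lcar (lcdr p))) K) else
  if lcar p == 5 then
    lev (lcar (lcdr p)) xs (lcons (lcons 1 (lcons (lcdr (lcdr p)) xs)) K) else
  if lcar p == 6 then
    if xs == 0 then 0 else
    if lcar xs == 0 then lev (lcar (lcdr p)) (lcdr xs) K else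
    lev p (lcons (lcar xs).-1 (lcdr xs))
      (lcons (lcons 3 (lcons (lcdr (lcdr p)) (lcons (lcar xs).-1 (lcdr xs)))) K) else
  lev (lcdr p) (lcons 0 xs) (lcons (lcons 4 (lcons (lcdr p) (lcons 0 xs))) K).

Definition lstep_rt ys k K :=
  if lcar k == 0 then lev (lcdr k) ys K else
  if lcar k == 1 then lev (lcar (lcdr k)) (lcdr (lcdr k)) (lcons (lcons 2 ys) K) else
  if lcar k == 2 then lrt (lapp (lcdr k) ys) K else
  if lcar k == 3 then
    lev (lcar (lcdr k)) (lcons (lcar (lcdr (lcdr k))) (lapp ys (lcdr (lcdr (lcdr k))))) K else
  if lcar ys == 0 then lrt (lcons (lcar (lcdr (lcdr k))) 0) K else
  lev (lcar (lcdr k)) (lcons (lcar (lcdr (lcdr k))).+1 (lcdr (lcdr (lcdr k))))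
    (lcons (lcons 4 (lcons (lcar (lcdr k))
       (lcons (lcar (lcdr (lcdr k))).+1 (lcdr (lcdr (lcdr k)))))) K).

Definition lstep_config c :=
  if c == 0 then 0 else
  if lcar c == 0 then
    lstep_ev (lcar (lcdr c)) (lcar (lcdr (lcdr c))) (lcdr (lcdr (lcdr c))) else
  if lcdr (lcdr c) == 0 then c else
  lstep_rt (lcar (lcdr c)) (lcar (lcdr (lcdr c))) (lcdr (lcdr (lcdr c))).

Lemma computable_lstep_ev k F G H :
  computable k.+1 F -> computable k.+1 G -> computable k.+1 H ->
  computable k.+1 (fun xs => lstep_ev (F xs) (G xs) (H xs)).
Proof. by move=> cF cG cH; rewrite /lstep_ev /lev /lrt; comp_auto. Qed.

Lemma computable_lstep_rt k F G H :
  computable k.+1 F -> computable k.+1 G -> computable k.+1 H ->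
  computable k.+1 (fun xs => lstep_rt (F xs) (G xs) (H xs)).
Proof. by move=> cF cG cH; rewrite /lstep_rt /lev /lrt; comp_auto. Qed.
Hint Resolve computable_lstep_ev computable_lstep_rt : computable.

Lemma computable_lstep_config k F :
  computable k.+1 F -> computable k.+1 (fun xs => lstep_config (F xs)).
Proof. by move=> cF; rewrite /lstep_config; comp_auto. Qed.
Hint Resolve computable_lstep_config : computable.

Lemma lstep_configE c : lstep_config (config_code c) = config_code (step c).
Proof.
case: c => [p xs K|ys K|] //=; rewrite /lstep_config ?lE /=.
  rewrite /lstep_ev; case: p => [||i|f g|f g|f g|f] /=;
    rewrite ?lE /= ?lcar_code ?lnth_code //.
  by case: xs => [|[|n] xs] //=; rewrite lcode_cons !lE /= ?lE.
case: K => [|k K] //=; rewrite lcode_cons !lE /lstep_rt.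
case: k => * /=; rewrite !lE /= ?lapp_code //.
by rewrite lcar_code; case: eqP.
Qed.

(** An index that does not decode starts at 0, the code of [Stuck], and so enumerates nothing. *)
Definition linit e x :=
  if lcar (lprog e) == 0 then 0 else lev (lprog e) (lcons x 0) 0.

(** The usual finite approximation $W_{e,s}$. *)
Definition stage e s x : bool :=
  let c := iter s lstep_config (linit e x) in (lcar c == 1) && (lcdr (lcdr c) == 0).

Lemma computable_stage k F G H :
  computable k.+1 F -> computable k.+1 G -> computable k.+1 H ->
  computable k.+1 (fun xs => nat_of_bool (stage (F xs) (G xs) (H xs))).
Proof.
move=> cF cG cH; rewrite /stage /linit /lev.
by apply: computable_and; apply: computable_eq; try do 2?apply: computable_lcdr;
  try apply: computable_lcar; try apply: computable_iter; comp_auto.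
Qed.
Hint Resolve computable_stage : computable.

Lemma haltedE c :
  (lcar (config_code c) == 1) && (lcdr (lcdr (config_code c)) == 0) = halted c.
Proof.
case: c => [p xs K|ys [|k K]|] //=; rewrite ?lcode_cons !lE //=.
Qed.

Lemma stageE e s x : stage e s x =
  if prog_of_nat e is Some p then halted (iter s step (Ev p [:: x] [::])) else false.
Proof.
rewrite /stage /linit; have := lprog_prog_of_nat e; case: prog_of_nat => [p|] ->.
  rewrite lcar_pcode.
  have -> : lev (pcode p) (lcons x 0) 0 = config_code (Ev p [:: x] [::]) by [].
  rewrite -haltedE; set c := Ev _ _ _.
  suff -> : iter s lstep_config (config_code c) = config_code (iter s step c) by [].
  by elim: s => //= s ->; rewrite lstep_configE.
by have -> : iter s lstep_config 0 = 0 by elim: s => //= s ->.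
Qed.

Lemma stage_mono e s t x : s <= t -> stage e s x -> stage e t x.
Proof.
by rewrite !stageE; case: prog_of_nat => // p; apply: halted_mono.
Qed.

Lemma W_stage e x : W e x <-> exists s, stage e s x.
Proof.
rewrite /W; split=> [|[s]].
  case E: prog_of_nat => [p|] // [ys /eval_steps/(_ [::])[n en]].
  by exists n; rewrite stageE E en.
rewrite stageE; case: prog_of_nat => // p /halted_eval[ys [m [_ e' _]]].
by exists ys.
Qed.

(** * The columns of the reduction *)

Lemma uniform_bound (P : nat -> nat -> Prop) n :
  (forall x s t, s <= t -> P x s -> P x t) ->
  (forall x, x < n -> exists s, P x s) -> exists s, forall x, x < n -> P x s.
Proof.
move=> mono; elim: n => [|n IHn] ex; first by exists 0.
have [|s hs] := IHn; first by move=> x lx; apply: ex; lia.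
have [t ht] := ex n (leqnn _); exists (maxn s t) => x.
rewrite ltnS leq_eqVlt => /orP[/eqP->|lx]; first by apply: mono ht; lia.
by apply: mono (hs _ lx); lia.
Qed.

Lemma finite_choice (P : nat -> nat -> Prop) n :
  (forall x, x < n -> exists y, P x y) ->
  exists s, forall x, x < n -> P x (nth 0 s x).
Proof.
move=> ex; suff [s [ss hs]] : exists s, size s = n /\ forall x, x < n -> P x (nth 0 s x).
  by exists s.
elim: n ex => [|n IHn] ex; first by exists [::].
have [|s [ss hs]] := IHn; first by move=> x lx; apply: ex; lia.
have [y hy] := ex n (leqnn _); exists (rcons s y); rewrite size_rcons ss; split=> // x lx.
by rewrite nth_rcons ss; have [/hs//|gt|->//] := ltngtP x n; lia.
Qed.

(** Equality of two columns in $\Pi_2$ form, for all u there is s. The bound u limits both the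
    elements and the stage at which they are observed, which makes the condition antitone in u. *)
Definition agree e n f m u s : bool :=
  all (fun x => (stage e u (cpair x n) ==> stage f s (cpair x m)) &&
                (stage f u (cpair x m) ==> stage e s (cpair x n))) (iota 0 u).

Lemma agreeP e n f m u s :
  reflect (forall x, x < u -> (stage e u (cpair x n) -> stage f s (cpair x m)) /\
                              (stage f u (cpair x m) -> stage e s (cpair x n)))
          (agree e n f m u s).
Proof.
apply: (iffP allP) => h x.
  by move=> lx; have := h x; rewrite mem_iota => /(_ lx)/andP[/implyP ? /implyP ?].
by rewrite mem_iota /= => /h[? ?]; apply/andP; split; apply/implyP.
Qed.

Lemma agree_antitone e n f m u v s : u <= v -> agree e n f m v s -> agree e n f m u s.
Proof.
move=> luv /agreeP h; apply/agreeP => x lx.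
by have [|h1 h2] := h x; [lia|split=> /(stage_mono luv)].
Qed.

(** An element x seen at stage u is covered by the bound max(x + 1, u). Conversely, only finitely
    many x < u have to be answered, and a late enough stage s answers all of them. *)
Lemma agree_WcolP e n f m :
  (forall u, exists s, agree e n f m u s) <-> (forall x, Wcol e n x <-> Wcol f m x).
Proof.
split=> h.
  move=> x; rewrite /Wcol !W_stage; split=> -[u hu];
    have [s /agreeP/(_ x)[|h1 h2]] := h (maxn x.+1 u); rewrite ?leq_maxl //;
    by exists s; (apply: h1 || apply: h2); apply: stage_mono hu; apply: leq_maxr.
move=> u; have [||s hs] := @uniform_bound (fun x s =>
    (stage e u (cpair x n) -> stage f s (cpair x m)) /\
    (stage f u (cpair x m) -> stage e s (cpair x n))) u; last by exists s; apply/agreeP.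
  by move=> x s t lst [h1 h2]; split=> [/h1|/h2]; apply: stage_mono.
move=> x _; have := h x; rewrite /Wcol !W_stage.
case E: (stage e u _); case F: (stage f u _) => -[h1 h2].
- by exists u.
- by have [|s hs] := h1; [exists u|exists s].
- by have [|s hs] := h2; [exists u|exists s].
by exists 0.
Qed.

Lemma computable_agree k E N F M U S :
  computable k.+1 E -> computable k.+1 N -> computable k.+1 F ->
  computable k.+1 M -> computable k.+1 U -> computable k.+1 S ->
  computable k.+1 (fun xs =>
    nat_of_bool (agree (E xs) (N xs) (F xs) (M xs) (U xs) (S xs))).
Proof.
by move=> *; rewrite /agree; apply: computable_all; comp_auto.
Qed.
Hint Resolve computable_agree : computable.

(** * From antitone conditions to almost equality *)

Section Sigma3.

Variable G : nat -> nat -> Prop.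
Hypothesis G_anti : forall z u v, u <= v -> G z v -> G z u.

Let H z t := exists2 y, y <= z & G y t.

Let H_anti z u v : u <= v -> H z v -> H z u.
Proof. by move=> luv [y ly /(G_anti luv)]; exists y. Qed.

Lemma lconsE x : 0 < x -> x = lcons (lcar x) (lcdr x).
Proof.
by have [[|a s] ->] := lcode_surj x => // _; rewrite lcode_cons !lE.
Qed.

(** Where the first coordinate is at least z0, both sides hold. For each of the finitely many z <
    z0, the antitone H z holds everywhere or fails from some t0 on; either way both sides agree for
    t > t0. *)
Lemma almost_agree_sigma3 z0 : (forall u, G z0 u) ->
  exists b, forall x, b <= x ->
    (H (lcar x) (lcdr x) <-> lcdr x = 0 \/ H (lcar x) (lcdr x).-1).
Proof.
move=> good.
have [||B hB] := @uniform_bound (fun z B => forall t, B <= t -> (H z t <-> t = 0 \/ H z t.-1)) z0.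
- by move=> z B C lBC h t lt; apply: h; lia.
- move=> z _; have [all|nall] := classic (forall t, H z t).
    by exists 0 => t _; split=> _; [right|]; apply: all.
  have [t0 nt0] := not_all_ex_not _ _ nall; exists t0.+1 => t lt; split=> [h|[t0'|h]].
  + by case: nt0; apply: H_anti h; lia.
  + lia.
  by case: nt0; apply: H_anti h; lia.
(* By monotonicity of [lcons], such an x has first coordinate at least z0 or second at least B.
   Moreover x > 0, so x is the pair of its coordinates. *)
exists (lcons z0 B).+1 => x lx; have [lz|lz] := leqP z0 (lcar x).
  by split=> _; [right|]; exists z0.
apply: hB => //; rewrite leqNgt; apply/negP => lB.
have := leq_lcons (ltnW lz) (ltnW lB); rewrite -lconsE //; lia.
Qed.

(** The witness has first coordinate b, which puts it above b. Antitonicity gives a common t at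
    which all G z with z <= b fail; going down from it to the least t where H b fails gives the
    second coordinate. *)
Lemma infinitely_differ_sigma3 : (forall z, exists u, ~ G z u) ->
  forall b, exists x, [/\ b <= x, ~ H (lcar x) (lcdr x) &
    lcdr x = 0 \/ H (lcar x) (lcdr x).-1].
Proof.
move=> bad b.
have [||t ht] := @uniform_bound (fun z u => ~ G z u) b.+1.
- by move=> z u v luv n /(G_anti luv).
- by move=> z _; apply: bad.
have {ht} : ~ H b t by move=> [y ly]; apply: ht.
elim: t => [|t IHt] nt.
  by exists (lcons b 0); rewrite !lE; split=> //; [apply/ltnW/gt_lcons_l|left].
have [h|/IHt//] := classic (H b t).
by exists (lcons b t.+1); rewrite !lE; split=> //; [apply/ltnW/gt_lcons_l|right].
Qed.

End Sigma3.

(* A column is c = <S, K> with S the list of membership flags and K the matrix of witnesses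
   k = <d, n>: column n of the set of a if d = 0, of b otherwise. A candidate is z = <a, <b, m>>. *)
Definition in_side c i := lnth (lcar c) i != 0.

(** The condition G(z, u) of the construction, verified by stage s; a nonzero [ldrop a l] says that
    a is a position of the tuple. *)
Definition test l c z u s : bool :=
  let a := lcar z in let b := lcar (lcdr z) in
  let k := lnth (lnth (lcdr c) a) b in
  [&& ldrop a l != 0, ldrop b l != 0, in_side c a, ~~ in_side c b &
    agree (lnth l (if lcar k == 0 then a else b)) (lcdr k)
          (lnth l (if lcar k == 0 then b else a)) (lcdr (lcdr z)) u s].

(** Raising t by one for the positions in S lets a single clause, t = 0 or H(z, t - 1), serve both
    kinds of positions: after the shift t is never 0. *)
Definition enum_at l j w s : bool :=
  let x := lcar (cunpair w) in let c := lcdr (cunpair w) in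
  let t := if in_side c j then (lcdr x).+1 else lcdr x in
  (t == 0) || has (fun z => test l c z t.-1 s) (iota 0 (lcar x).+1).

Lemma computable_in_side k F G :
  computable k.+1 F -> computable k.+1 G ->
  computable k.+1 (fun xs => nat_of_bool (in_side (F xs) (G xs))).
Proof. by move=> *; rewrite /in_side; comp_auto. Qed.
Hint Resolve computable_in_side : computable.

Lemma computable_test k L C Z U S :
  computable k.+1 L -> computable k.+1 C -> computable k.+1 Z ->
  computable k.+1 U -> computable k.+1 S ->
  computable k.+1 (fun xs => nat_of_bool (test (L xs) (C xs) (Z xs) (U xs) (S xs))).
Proof. by move=> *; rewrite /test /=; comp_auto. Qed.
Hint Resolve computable_test : computable.

Lemma computable_enum_at k L J X S :
  computable k.+1 L -> computable k.+1 J -> computable k.+1 X -> computable k.+1 S ->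
  computable k.+1 (fun xs => nat_of_bool (enum_at (L xs) (J xs) (X xs) (S xs))).
Proof.
move=> *; rewrite /enum_at; apply: computable_or; first by comp_auto.
by apply: computable_has; comp_auto.
Qed.
Hint Resolve computable_enum_at : computable.

Lemma Eset_sym a b : Eset a b -> Eset b a.
Proof.
move=> [E1 E2]; split=> n; [have [m h] := E2 n|have [m h] := E1 n];
by exists m => x; rewrite h.
Qed.

Lemma Eset_trans a b c : Eset a b -> Eset b c -> Eset a c.
Proof.
move=> [E1 E2] [F1 F2]; split=> n.
  by have [m h] := E1 n; have [p h'] := F1 m; exists p => x; rewrite h.
by have [m h] := F2 n; have [p h'] := E2 m; exists p => x; rewrite h'.
Qed.

(** Classically, one of the two inclusions between the families of columns fails at some column;
    [lcar k] records which inclusion. *)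
Lemma not_Eset_witness a b : ~ Eset a b -> exists k, forall m,
  ~ (if lcar k == 0 then forall x, Wcol a (lcdr k) x <-> Wcol b m x
     else forall x, Wcol b (lcdr k) x <-> Wcol a m x).
Proof.
move=> nE; apply: NNPP => nk; apply: nE; split=> n; apply: NNPP => nm; apply: nk.
  by exists (lcons 0 n) => m; rewrite !lE /= => h; apply: nm; exists m.
by exists (lcons 1 n) => m; rewrite !lE /= => h; apply: nm; exists m => x; rewrite h.
Qed.

(** * Correctness of the reduction *)

Section Reduction.

Variables (xs : seq nat) (y : nat -> nat).
Hypothesis W_y : forall j w, W (y j) w <-> exists s, enum_at (lcode xs) j w s.

Let good c z u := exists s, test (lcode xs) c z u s.

Let good_anti c z u v : u <= v -> good c z v -> good c z u.
Proof.
move=> luv [s /and5P[h1 h2 h3 h4 h5]]; exists s; apply/and5P; split=> //.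
exact: agree_antitone h5.
Qed.

Lemma Wcol_y c j x : Wcol (y j) c x <->
  (if in_side c j then exists2 z, z <= lcar x & good c z (lcdr x)
   else lcdr x = 0 \/ exists2 z, z <= lcar x & good c z (lcdr x).-1).
Proof.
rewrite /Wcol W_y /enum_at cunpairK !lE; case: ifP => _; split.
- move=> [s /orP[//|/hasP[z]]]; rewrite mem_iota add0n ltnS => lz h.
  by exists z => //; exists s.
- move=> [z lz [s h]]; exists s; apply/orP; right; apply/hasP; exists z => //.
  by rewrite mem_iota add0n ltnS.
- move=> [s /orP[/eqP->|/hasP[z]]]; first by left.
  by rewrite mem_iota add0n ltnS => lz h; right; exists z => //; exists s.
move=> [->|[z lz [s h]]]; first by exists 0.
by exists s; apply/orP; right; apply/hasP; exists z => //; rewrite mem_iota add0n ltnS.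
Qed.

Let e i := nth 0 xs i.

Lemma goodP c z :
  let a := lcar z in let b := lcar (lcdr z) in
  let k := lnth (lnth (lcdr c) a) b in a < size xs -> b < size xs ->
  (forall u, good c z u) <->
  [/\ in_side c a, ~~ in_side c b &
    if lcar k == 0 then forall x, Wcol (e a) (lcdr k) x <-> Wcol (e b) (lcdr (lcdr z)) x
    else forall x, Wcol (e b) (lcdr k) x <-> Wcol (e a) (lcdr (lcdr z)) x].
Proof.
move=> a b k la lb; rewrite /good /test !ldrop_eq0 -!ltnNge la lb /= -/k !lnth_code.
split.
  (* The conditions on the sides do not mention u, so they can be read off at u = 0. *)
  move=> h; have [s /and3P[h1 h2 _]] := h 0; split=> //.
  by case: ifP h => _ h; apply/agree_WcolP => u;
    have [s' /and3P[_ _ ?]] := h u; exists s'.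
move=> [-> -> h] u /=.
by case: ifP h => _ /agree_WcolP/(_ u).
Qed.

(** Whatever column the guess offers as a witness against i and j, equivalence supplies an equal
    column m on the other side, so the candidate (i, j, m) is good. *)
Lemma almost_equal_sides i j c : i < size xs -> j < size xs ->
  in_side c i -> ~~ in_side c j -> Eset (e i) (e j) ->
  exists b, forall x, b <= x -> (Wcol (y i) c x <-> Wcol (y j) c x).
Proof.
move=> li lj ci cj [E1 E2].
suff [z0 gz] : exists z, forall u, good c z u.
  have [b hb] := almost_agree_sigma3 (@good_anti c) gz.
  by exists b => x /hb; rewrite !Wcol_y ci (negbTE cj).
pose k := lnth (lnth (lcdr c) i) j.
have [m hm] : exists m, if lcar k == 0
    then forall x, Wcol (e i) (lcdr k) x <-> Wcol (e j) m x
    else forall x, Wcol (e j) (lcdr k) x <-> Wcol (e i) m x.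
  case: (lcar k == 0); first exact: E1.
  by have [n hn] := E2 (lcdr k); exists n => x; rewrite hn.
by exists (lcons i (lcons j m)); apply/goodP; rewrite !lE.
Qed.

Lemma Eset_E3 i j : i < size xs -> j < size xs -> Eset (e i) (e j) -> E3 (y i) (y j).
Proof.
move=> li lj E c; case ci: (in_side c i); case cj: (in_side c j).
- by exists 0 => x _; rewrite !Wcol_y ci cj.
- by apply: almost_equal_sides; rewrite ?ci ?cj.
- have [||b hb] := @almost_equal_sides j i c lj li _ _ (Eset_sym E); rewrite ?ci ?cj //.
  by exists b => x /hb ->.
by exists 0 => x _; rewrite !Wcol_y ci cj.
Qed.

(** If i and j were inequivalent, a correct guess c would have no good candidate, and column c would
    separate [y i] from [y j] at arbitrarily large x. *)
Lemma E3_Eset i j : i < size xs -> j < size xs -> E3 (y i) (y j) -> Eset (e i) (e j).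
Proof.
move=> li lj E; apply: NNPP => nE.
(* The flags mark the equivalence class of i. *)
have [|S hS] := @finite_choice (fun a v => v != 0 <-> Eset (e i) (e a)) (size xs).
  move=> a _; have [h|h] := classic (Eset (e i) (e a)); first by exists 1.
  by exists 0.
(* Genuine witnesses for the inequivalent pairs, 0 elsewhere; choice is applied within each row and
   then over the coded rows. *)
have [|K hK] := @finite_choice (fun a Ka => forall b, b < size xs ->
    ~ Eset (e a) (e b) -> forall m, let k := lnth Ka b in
  ~ (if lcar k == 0 then forall x, Wcol (e a) (lcdr k) x <-> Wcol (e b) m x
     else forall x, Wcol (e b) (lcdr k) x <-> Wcol (e a) m x)) (size xs).
  move=> a la.
  have [|Ka hKa] := @finite_choice (fun b k => ~ Eset (e a) (e b) -> forall m,
    ~ (if lcar k == 0 then forall x, Wcol (e a) (lcdr k) x <-> Wcol (e b) m x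
       else forall x, Wcol (e b) (lcdr k) x <-> Wcol (e a) m x)) (size xs).
    move=> b lb; have [h|h] := classic (Eset (e a) (e b)); first by exists 0.
    by have [k hk] := not_Eset_witness h; exists k.
  by exists (lcode Ka) => b lb /(hKa _ lb) h m; rewrite /= lnth_code.
pose c := lcons (lcode S) (lcode K).
have sideE a : a < size xs -> in_side c a <-> Eset (e i) (e a).
  by move=> /hS; rewrite /in_side /c lE lnth_code.
have ci : in_side c i by apply/sideE => //; split=> n; exists n.
have cj : ~~ in_side c j by apply/negP => /(sideE j lj).
have bad z : exists u, ~ good c z u.
  apply: NNPP => nu; have {nu} g u : good c z u by apply: NNPP => h; apply: nu; exists u.
  (* A single passed test already places a and b inside the tuple. *)
  have [s] := g 0; rewrite /test => /and3P[].
  rewrite !ldrop_eq0 -!ltnNge => la lb _.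
  have /= [ca cb] := (goodP c la lb).1 g.
  rewrite [lcdr c]lE [lnth (lcode K) _]lnth_code; apply: (hK _ la _ lb).
  (* Otherwise b would be in the class of i along with a. *)
  move=> E'; move/negP: cb; apply; apply/sideE => //.
  by apply: Eset_trans E'; apply/sideE.
have [b hb] := E c; have [x [lx n1 n2]] := infinitely_differ_sigma3 (@good_anti c) bad b.
by apply: n1; have := hb x lx; rewrite !Wcol_y ci (negbTE cj) => ->.
Qed.

End Reduction.

(** * Indices of the constructed sets *)

Fixpoint tree_of_prog (p : prog) : GenTree.tree nat :=
  match p with
  | PZero => GenTree.Node 0 [::]
  | PSucc => GenTree.Node 1 [::]
  | PProj i => GenTree.Node 2 [:: GenTree.Leaf i]
  | PComp f g => GenTree.Node 3 [:: tree_of_prog f; tree_of_prog g]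
  | PPair f g => GenTree.Node 4 [:: tree_of_prog f; tree_of_prog g]
  | PRec f g => GenTree.Node 5 [:: tree_of_prog f; tree_of_prog g]
  | PMu f => GenTree.Node 6 [:: tree_of_prog f]
  end.

Lemma tree_of_progK : pcancel tree_of_prog decode.
Proof. by elim=> //= [f -> g ->|f -> g ->|f -> g ->|f ->]. Qed.

Definition prog_index (p : prog) : nat := pickle (tree_of_prog p).

Lemma prog_of_prog_index p : prog_of_nat (prog_index p) = Some p.
Proof. by rewrite /prog_of_nat /prog_index pickleK /= tree_of_progK. Qed.

Fixpoint const_prog n := if n is n'.+1 then PComp PSucc (const_prog n') else PZero.

Lemma eval_const_prog n xs : eval (const_prog n) xs [:: n].
Proof.
elim: n => [|n IHn] /=; first exact: eZero.
by apply: eComp IHn (eSucc _).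
Qed.

Lemma prog_index_foldr p :
  prog_index p = foldr lcons 0 (map pickle (GenTree.encode (tree_of_prog p))).
Proof. by []. Qed.

(** The symbols [inl 4], [inl 2], [inl 0] open a composition and spell [PSucc]; [inl 1], [inl 0]
    spell [PZero]; the last n symbols [inl 0] close the compositions. This presents the index as an
    iteration in n. *)
Lemma foldr_encode_const (it : nat + nat -> nat) (f : nat -> nat -> nat) n s :
  foldr f s (map it (GenTree.encode (tree_of_prog (const_prog n)))) =
  iter n (fun r => f (it (inl 4)) (f (it (inl 2)) (f (it (inl 0)) r)))
    (f (it (inl 1)) (f (it (inl 0)) (iter n (f (it (inl 0))) s))).
Proof.
elim: n s => [|n IHn] s //.
by rewrite [iter n.+1 _ s]iterSr iterS -IHn /= cats0 map_rcons foldr_rcons.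
Qed.

Lemma computable_foldr_lcons k F s :
  computable k.+1 F -> computable k.+1 (fun xs => foldr lcons (F xs) s).
Proof.
by move=> cF; elim: s => [|x s IHs]; rewrite /=; comp_auto.
Qed.

(** Kleene's s-m-n construction: c is fixed as the second input of q. *)
Definition smn q c := PComp q (PPair (PProj 0) (const_prog c)).

(** Only the block of [const_prog c] in the encoding depends on c; it stands between two fixed
    lists. *)
Lemma foldr_encode_smn (it : nat + nat -> nat) q :
  exists pre post, forall (f : nat -> nat -> nat) c,
  foldr f 0 (map it (GenTree.encode (tree_of_prog (smn q c)))) =
  foldr f (foldr f (foldr f 0 post)
    (map it (GenTree.encode (tree_of_prog (const_prog c))))) pre.
Proof.
pose enc p := map it (GenTree.encode (tree_of_prog p)).
exists (it (inl 4) :: enc q ++ it (inl 5) :: enc (PProj 0)).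
exists [:: it (inl 0); it (inl 0)] => f c.
rewrite -!foldr_cat; congr foldr; rewrite /enc /= !cats0 map_rcons map_cat /= map_rcons.
by rewrite -!cats1 -!catA /= -!catA.
Qed.

Lemma computable_prog_index_smn k q F :
  computable k.+1 F -> computable k.+1 (fun xs => prog_index (smn q (F xs))).
Proof.
move=> cF; have [pre [post e]] := foldr_encode_smn pickle q.
suff : computable k.+1 (fun xs => foldr lcons (foldr lcons (foldr lcons 0 post)
    (map pickle (GenTree.encode (tree_of_prog (const_prog (F xs)))))) pre).
  by apply: computable_ext => xs _; rewrite prog_index_foldr; apply/esym/(e lcons).
(* The symbols enter only as constants, so [pickle] is replaced by a variable. *)
apply: computable_foldr_lcons; move: pickle => it.
suff : computable k.+1 (fun xs => iter (F xs)
    (fun r => lcons (it (inl 4)) (lcons (it (inl 2)) (lcons (it (inl 0)) r)))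
    (lcons (it (inl 1)) (lcons (it (inl 0))
      (iter (F xs) (lcons (it (inl 0))) (foldr lcons 0 post))))).
  by apply: computable_ext => xs _; rewrite foldr_encode_const.
apply: computable_iter; comp_auto.
by do 2!(apply: computable_lcons; first by comp_auto); apply: computable_iter; comp_auto.
Qed.
Hint Resolve computable_prog_index_smn : computable.

(** The program searches for s and halts iff the search succeeds; P computes the negated test
    because [PMu] looks for a zero. *)
Lemma W_smn_mu P (T : nat -> nat -> nat -> bool) :
  (forall s w c, eval P [:: s; w; c] [:: nat_of_bool (~~ T s w c)]) ->
  forall w c, W (prog_index (smn (PMu P) c)) w <-> exists s, T s w c.
Proof.
move=> hP w c; rewrite /W prog_of_prog_index /smn.
have ew : eval (PPair (PProj 0) (const_prog c)) [:: w] [:: w; c].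
  exact: (ePair (eProj 0 [:: w]) (eval_const_prog c _)).
split=> [[zs e]|exT].
  inversion e as [| | |f g xs ys zs' e1 e2| | | |]; subst.
  move: e2; rewrite (eval_det e1 ew) => e2.
  inversion e2 as [| | | | | | |f xs n _ [ys' [e3 y0]]]; subst.
  exists n; move: y0; rewrite (eval_det e3 (hP _ _ _)) /=.
  by case: (T _ _ _).
(* [eMu] requires nonzero values below the result, hence the least s. *)
have [s Ts smin] := ex_minnP exT.
exists [:: s]; apply: eComp ew _; apply: eMu => [m lm|].
  exists [:: nat_of_bool (~~ T m w c)]; split; first exact: hP.
  by case E: (T m w c) => //; have := smin m E; rewrite leqNgt lm.
by exists [:: 0]; have := hP s w c; rewrite Ts.
Qed.

Lemma pickle_seq_nat (s : seq nat) : pickle s = lcode s.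
Proof. by rewrite -[s in RHS]map_id. Qed.

Theorem theorem3p3 : fin_reducible Eset E3.
Proof.
have [P hP] : computable 3 (fun v => nat_of_bool
    (~~ enum_at (lcar (nth 0 v 2)) (lcdr (nth 0 v 2)) (nth 0 v 1) (nth 0 v 0))).
  by comp_auto.
(* The tuple code and the position are packed into the one parameter that [smn] fixes. *)
pose y l j := prog_index (smn (PMu P) (lcons l j)).
have W_y l j w : W (y l j) w <-> exists s, enum_at l j w s.
  rewrite (@W_smn_mu P (fun s w c => enum_at (lcar c) (lcdr c) w s)) ?lE //.
  by move=> s v c; apply: (hP [:: s; v; c]).
(* The output is the code of the list of indices, tabulated over the positions of the input
   tuple. *)
have [p hp] : computable 1 (fun v => ltab (y (nth 0 v 0)) (lsize (nth 0 v 0))).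
  rewrite /ltab /y; apply: computable_iteri; [by comp_auto|by comp_auto|].
  by apply: computable_lcons; [apply: computable_prog_index_smn|]; comp_auto.
exists p; split=> [m|xs _]; first by exists [:: ltab (y m) (lsize m)]; apply: (hp [:: m]).
exists [:: ltab (y (lcode xs)) (size xs)], (mkseq (y (lcode xs)) (size xs)); split.
  by rewrite pickle_seq_nat; have := hp [:: lcode xs] erefl; rewrite /= lsize_code.
split; first by rewrite ltabE /= -pickle_seq_nat pickleK.
rewrite size_mkseq; split=> // i j lij ljn; rewrite !nth_mkseq ?(ltn_trans lij) //.
split; first by apply: (Eset_E3 (W_y _)) => //; apply: ltn_trans lij _.
by apply: (E3_Eset (W_y _)) => //; apply: ltn_trans lij _.
Qed.
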